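(* Let $q>0$, let $m\ge 1$, and let $A:\mathbb{R}\to\mathcal{M}(m,\mathbb{C})$ be continuous and $q$-periodic, i.e. $A(t+q)=A(t)$ for all $t\in\mathbb{R}$. Let $\Phi:\mathbb{R}\to\mathcal{M}(m,\mathbb{C})$ be the unique solution of $\dot{\Phi}(t)=A(t)\Phi(t)$, $\Phi(0)=I$, and assume that $\Phi(t)\Phi^{-1}(s)=\Phi^{-1}(s)\Phi(t)$ for all $t,s\in\mathbb{R}$. Put $U(t,s)=\Phi(t)\Phi^{-1}(s)$, $V(t,s)=U^{-1}(t,s)=\Phi(s)\Phi^{-1}(t)$, and $L=U(q,0)$, and for $\mu\in\mathbb{R}$ put $$\Phi_\mu(q)=\int_0^q U(q,s)e^{i\mu s}\,ds,\qquad \Psi_\mu(q)=\int_0^q V(q,s)e^{i\mu s}\,ds .$$ If the matrix $L$ is dichotomic and there exists a projection $P:\mathbb{C}^m\to\mathbb{C}^m$ commuting with $L$, and with $\Phi_\mu(q)$ and $\Psi_\mu(q)$ for every $\mu\in\mathbb{R}$, then for each $\mu\in\mathbb{R}$ and each non-zero vector $b\in\mathbb{C}^m$ the solutions of the Cauchy problems $(A(t),\mu,Pb,0)$ and $(-A(t),\mu,(I-P)b,0)$, namely $$t\mapsto\int_0^t U(t,s)e^{i\mu s}Pb\,ds\qquad\text{and}\qquad t\mapsto\int_0^t V(t,s)e^{i\mu s}(I-P)b\,ds,$$ are bounded on $[0,\infty)$.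
   Context: $\mathcal{M}(m,\mathbb{C})$ is the set of $m\times m$ complex matrices and $I$ is the identity matrix. The matrix $\Phi(t)$ is invertible for every $t$. A matrix $L$ is called dichotomic if its spectrum $\sigma(L)$ does not intersect the unit circle $\{z\in\mathbb{C}:|z|=1\}$. A projection is a linear map $P:\mathbb{C}^m\to\mathbb{C}^m$ with $P^2=P$. The matrix $L=U(q,0)$ is called the Poincaré map. The Cauchy problem $(A(t),\mu,Pb,0)$ is $\dot X(t)=A(t)X(t)+e^{i\mu t}Pb$, $t\ge0$, $X(0)=0$; its solution is $\int_0^t U(t,s)e^{i\mu s}Pb\,ds$. The Cauchy problem $(-A(t),\mu,(I-P)b,0)$ is written $\dot X(t)=-X(t)A(t)+e^{i\mu t}(I-P)b$, $t\ge 0$, $X(0)=0$; by its solution is meant the function $\int_0^t V(t,s)e^{i\mu s}(I-P)b\,ds$.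
   Formalization: The claim is not proved for every commuting projection P (it fails for m=1, A=1, P=I, μ=0, b=1); it is proved that some projection P commuting with L, Φ_μ(q) and Ψ_μ(q) makes both solutions bounded for all μ and b. *)

(* Defs.v *)
From HB Require Import structures.
From mathcomp Require Export all_boot all_order all_algebra.
From mathcomp Require Export all_classical all_reals all_analysis.
From mathcomp Require Export complex.

Set Implicit Arguments.
Unset Strict Implicit.
Unset Printing Implicit Defensive.

Import Order.TTheory GRing.Theory Num.Theory.
Import numFieldNormedType.Exports.

Local Open Scope classical_set_scope.
Local Open Scope ring_scope.

(* The library has no topology or measure on R[i] coming from that of R, so
   continuity, derivatives in the real variable and integrals of functions with
   values in complex matrices are taken entrywise on real and imaginary parts. *)

Definition mx_continuous (R : realType) (m n : nat)
    (F : R -> 'M[R[i]]_(m, n)) : Prop :=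
  forall i j, continuous (fun t : R => complex.Re (F t i j)) /\
              continuous (fun t : R => complex.Im (F t i j)).

Definition mx_has_derivative (R : realType) (m n : nat)
    (F : R -> 'M[R[i]]_(m, n)) (t : R) (D : 'M[R[i]]_(m, n)) : Prop :=
  forall i j,
    is_derive t 1 (fun s : R => complex.Re (F s i j)) (complex.Re (D i j)) /\
    is_derive t 1 (fun s : R => complex.Im (F s i j)) (complex.Im (D i j)).

(* \int_0^t F(s) ds, for t >= 0. *)
Definition mx_integral (R : realType) (m n : nat)
    (F : R -> 'M[R[i]]_(m, n)) (t : R) : 'M[R[i]]_(m, n) :=
  \matrix_(i, j)
    Complex (Rintegral (@lebesgue_measure R) `[0, t]
               (fun s => complex.Re (F s i j)))
            (Rintegral (@lebesgue_measure R) `[0, t]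
               (fun s => complex.Im (F s i j))).

(* e^{i x} for real x. *)
Definition cis (R : realType) (x : R) : R[i] := Complex (cos x) (sin x).

Definition bounded_on_nonneg (R : realType) (m : nat)
    (x : R -> 'cV[R[i]]_m) : Prop :=
  exists M : R, forall t : R, 0 <= t ->
    forall i, `|x t i 0| <= real_complex R M.

Definition fundamental_solution (R : realType) (m : nat)
    (A Phi : R -> 'M[R[i]]_m) : Prop :=
  (forall t : R, mx_has_derivative Phi t (A t *m Phi t)) /\ Phi 0 = 1%:M.

Definition evolU (R : realType) (m : nat) (Phi : R -> 'M[R[i]]_m)
    (t s : R) : 'M[R[i]]_m := Phi t *m invmx (Phi s).

Definition evolV (R : realType) (m : nat) (Phi : R -> 'M[R[i]]_m)
    (t s : R) : 'M[R[i]]_m := Phi s *m invmx (Phi t).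

Definition poincare (R : realType) (m : nat) (Phi : R -> 'M[R[i]]_m)
    (q : R) : 'M[R[i]]_m := evolU Phi q 0.

Definition Phi_mu (R : realType) (m : nat) (Phi : R -> 'M[R[i]]_m)
    (q mu : R) : 'M[R[i]]_m :=
  mx_integral (fun s => cis (mu * s) *: evolU Phi q s) q.

Definition Psi_mu (R : realType) (m : nat) (Phi : R -> 'M[R[i]]_m)
    (q mu : R) : 'M[R[i]]_m :=
  mx_integral (fun s => cis (mu * s) *: evolV Phi q s) q.

(* eigenvalue refers to row eigenvectors, which give the same spectrum. *)
Definition dichotomic (R : realType) (m : nat) (L : 'M[R[i]]_m) : Prop :=
  forall z : R[i], eigenvalue L z -> `|z| != 1.

Definition commuting_projection (R : realType) (m : nat)
    (Phi : R -> 'M[R[i]]_m) (q : R) (P : 'M[R[i]]_m) : Prop :=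
  [/\ P *m P = P,
      comm_mx P (poincare Phi q),
      forall mu : R, comm_mx P (Phi_mu Phi q mu) &
      forall mu : R, comm_mx P (Psi_mu Phi q mu)].

(* The solution of the Cauchy problem (A(t), mu, c, 0). *)
Definition solU (R : realType) (m : nat) (Phi : R -> 'M[R[i]]_m)
    (mu : R) (c : 'cV[R[i]]_m) (t : R) : 'cV[R[i]]_m :=
  mx_integral (fun s => evolU Phi t s *m (cis (mu * s) *: c)) t.

(* What is meant by the solution of the Cauchy problem (-A(t), mu, c, 0). *)
Definition solV (R : realType) (m : nat) (Phi : R -> 'M[R[i]]_m)
    (mu : R) (c : 'cV[R[i]]_m) (t : R) : 'cV[R[i]]_m :=
  mx_integral (fun s => evolV Phi t s *m (cis (mu * s) *: c)) t.

(* Main.v *)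
(** As L = Phi(q) is dichotomic, chi_L splits into coprime factors with roots
    inside and outside the unit circle; P is the associated spectral projection,
    so that L^k P and L^-k (I - P) decay exponentially. It is a polynomial in L,
    hence commutes with every Phi(s) and therefore with all the integrals.
    Floquet's relation Phi(v + k q) = Phi(v) L^k then gives
    |U(t,s) P|, |V(t,s) (I - P)| <= K e^(-b (t - s)) for 0 <= s <= t, and the
    integrals over [0,t] are at most of order K / b, for every frequency mu. *)
Require Import Defs.
From mathcomp Require Import ring lra.

Set Implicit Arguments.
Unset Strict Implicit.
Unset Printing Implicit Defensive.

Import Order.TTheory GRing.Theory Num.Theory.
Import numFieldNormedType.Exports.

Local Open Scope classical_set_scope.
Local Open Scope ring_scope.

(** * Exponential decay of matrix powers and the spectral projection *)

Local Notation normc := Normc.normc.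

(** The entrywise l1 norm: real-valued, and submultiplicative for rectangular shapes, so that it
    serves vectors and operators alike. *)
Definition mxnorm1 (R : realType) (m n : nat) (X : 'M[R[i]]_(m, n)) : R :=
  \sum_i \sum_j normc (X i j).

Section MatrixNorm.
Variable R : realType.

Lemma normc_ge0 (z : R[i]) : 0 <= normc z.
Proof. by case: z => a b /=; exact: sqrtr_ge0. Qed.

Lemma ler_normc_sum (I : finType) (F : I -> R[i]) :
  normc (\sum_i F i) <= \sum_i normc (F i).
Proof.
elim/big_ind2: _ => [|x a y b xa yb|//]; first by rewrite Normc.normc0.
by apply: le_trans (lerD xa yb); exact: le_normcD.
Qed.

Lemma ReD (x y : R[i]) :
  complex.Re (x + y) = complex.Re x + complex.Re y.
Proof. by case: x; case: y. Qed.

Lemma ImD (x y : R[i]) :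
  complex.Im (x + y) = complex.Im x + complex.Im y.
Proof. by case: x; case: y. Qed.

Lemma ReM (x y : R[i]) : complex.Re (x * y) =
  complex.Re x * complex.Re y - complex.Im x * complex.Im y.
Proof. by case: x; case: y. Qed.

Lemma ImM (x y : R[i]) : complex.Im (x * y) =
  complex.Re x * complex.Im y + complex.Im x * complex.Re y.
Proof. by case: x; case: y. Qed.

Lemma normr_Re_le (z : R[i]) : `|complex.Re z| <= normc z.
Proof. by have := normc_ge_Re z; rewrite lecR. Qed.

Lemma normr_Im_le (z : R[i]) : `|complex.Im z| <= normc z.
Proof.
case: z => a b /=; rewrite -(ler_sqr (normr_ge0 _)) ?nnegrE ?sqrtr_ge0//.
by rewrite sqr_sqrtr ?addr_ge0 ?sqr_ge0// real_normK ?num_real// lerDr sqr_ge0.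
Qed.

Lemma normc_le_ReIm (z : R[i]) :
  normc z <= `|complex.Re z| + `|complex.Im z|.
Proof.
case: z => a b /=; rewrite -ler_sqr ?nnegrE ?sqrtr_ge0 ?addr_ge0//.
rewrite sqr_sqrtr ?addr_ge0 ?sqr_ge0// sqrrD !real_normK ?num_real//.
by rewrite addrAC lerDl mulrn_wge0// mulr_ge0.
Qed.

Lemma mxnorm1_ge0 m n (X : 'M[R[i]]_(m, n)) : 0 <= mxnorm1 X.
Proof. by apply: sumr_ge0 => i _; apply: sumr_ge0 => j _; exact: normc_ge0. Qed.

Lemma normc_le_mxnorm1 m n (X : 'M[R[i]]_(m, n)) i j :
  normc (X i j) <= mxnorm1 X.
Proof.
rewrite /mxnorm1 (bigD1 i)//= (bigD1 j)//= -addrA lerDl addr_ge0//.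
  by apply: sumr_ge0 => k _; exact: normc_ge0.
by do 2![apply: sumr_ge0 => ? _]; exact: normc_ge0.
Qed.

Lemma mxnorm1D m n (X Y : 'M[R[i]]_(m, n)) :
  mxnorm1 (X + Y) <= mxnorm1 X + mxnorm1 Y.
Proof.
rewrite /mxnorm1 -big_split ler_sum// => i _; rewrite -big_split ler_sum// => j _.
by rewrite mxE; exact: le_normcD.
Qed.

Lemma mxnorm1Z m n (z : R[i]) (X : 'M[R[i]]_(m, n)) :
  mxnorm1 (z *: X) = normc z * mxnorm1 X.
Proof.
rewrite /mxnorm1 mulr_sumr; apply: eq_bigr => i _; rewrite mulr_sumr.
by apply: eq_bigr => j _; rewrite mxE Normc.normcM.
Qed.

Lemma mxnorm1M m n p (X : 'M[R[i]]_(m, n)) (Y : 'M[R[i]]_(n, p)) :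
  mxnorm1 (X *m Y) <= mxnorm1 X * mxnorm1 Y.
Proof.
rewrite /mxnorm1 mulr_suml ler_sum// => i _.
apply: (@le_trans _ _ (\sum_j \sum_k normc (X i k) * normc (Y k j))).
  apply: ler_sum => j _; rewrite mxE.
  apply: le_trans (ler_normc_sum _) _.
  by apply: ler_sum => k _; rewrite Normc.normcM.
rewrite exchange_big mulr_suml ler_sum// => k _; rewrite -mulr_sumr.
rewrite ler_wpM2l ?normc_ge0//.
rewrite [leRHS](bigD1 k)//= lerDl.
by do 2![apply: sumr_ge0 => ? _]; exact: normc_ge0.
Qed.

End MatrixNorm.

Section PowerDecay.
Variables (R : realType) (n : nat).
Implicit Types (L P : 'M[R[i]]_n.+1).

Local Notation Xprod s := (\prod_(z <- s) ('X - z%:P)).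

(* Peeling off the root [z], the norms [u_k] of [L^k X] satisfy
   [u_(k+1) <= |z| u_k + C rho^k] with [|z| < rho], so no Jordan form is needed. *)
Lemma power_decay_roots L p (X : 'M[R[i]]_(n.+1, p)) (s : seq R[i]) (rho : R) :
  0 < rho -> {in s, forall z, normc z < rho} ->
  horner_mx L (Xprod s) *m X = 0 ->
  exists C : R, forall k, mxnorm1 (L ^+ k *m X) <= C * rho ^+ k.
Proof.
move=> rho0; elim: s X => [|z s IH] X sr.
  rewrite big_nil rmorph1 mul1mx => ->; exists 0 => k.
  by rewrite mulmx0 mul0r /mxnorm1 big1// => i _; rewrite big1// => j _;
     rewrite mxE Normc.normc0.
rewrite big_cons mulrC rmorphM rmorphB /= horner_mx_X horner_mx_C -mulmxA => LX0.
have zr : normc z < rho by apply: sr; rewrite mem_head.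
have [|C HC] := IH ((L - z%:M) *m X) _ LX0.
  by move=> w ws; apply: sr; rewrite inE ws orbT.
have rz : 0 < rho - normc z by rewrite subr_gt0.
(* The first entry of the maximum settles [k = 0]; the second gives [C <= D * (rho - |z|)], that is
   [|z| D + C <= rho D], which is the inductive step. *)
pose D := Num.max (mxnorm1 X) (C / (rho - normc z)).
exists D; elim=> [|k IHk].
  by rewrite expr0 mulr1 mul1mx le_max lexx.
have -> : L ^+ k.+1 *m X = z *: (L ^+ k *m X) + L ^+ k *m ((L - z%:M) *m X).
  rewrite exprSr -mulmxA mulmxBl mul_scalar_mx mulmxBr scalemxAr addrC.
  by rewrite subrK.
apply: le_trans (mxnorm1D _ _) _; rewrite mxnorm1Z.
apply: (@le_trans _ _ (normc z * (D * rho ^+ k) + C * rho ^+ k)).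
  by rewrite lerD// ler_wpM2l ?normc_ge0.
have CD : C <= D * (rho - normc z) by rewrite -ler_pdivrMr// le_max lexx orbT.
rewrite exprS mulrA mulrA -mulrDl ler_wpM2r ?exprn_ge0 ?(ltW rho0)//.
by rewrite -lerBrDl [normc z * _]mulrC -mulrBr.
Qed.

Lemma normc_lt1_expR (s : seq R[i]) : {in s, forall z, normc z < 1} ->
  exists2 a : R, 0 < a & {in s, forall z, normc z < expR (- a)}.
Proof.
elim: s => [_|z s IH sr]; first by exists 1.
have [|a a0 Ha] := IH; first by move=> w ws; apply: sr; rewrite inE ws orbT.
have z1 : normc z < 1 by apply: sr; rewrite mem_head.
have z0 := normc_ge0 z.
(* The midpoint of [|z|] and 1 lies strictly above [|z|] and stays positive even for [z = 0], so its
   logarithm gives a rate in every case. *)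
have w0 : 0 < (1 + normc z) / 2 by lra.
pose b := Num.min a (- ln ((1 + normc z) / 2)).
exists b => [|w].
  by rewrite lt_min a0 oppr_gt0 ln_lt0//; lra.
rewrite inE => /orP[/eqP->|/Ha wa].
  apply: (@lt_le_trans _ _ ((1 + normc z) / 2)); first lra.
  rewrite -[leLHS]lnK ?posrE// ler_expR lerNr.
  by rewrite ge_min lexx orbT.
by apply: (lt_le_trans wa); rewrite ler_expR lerN2 ge_min lexx.
Qed.

Lemma power_decay L p (X : 'M[R[i]]_(n.+1, p)) (s : seq R[i]) :
  {in s, forall z, normc z < 1} ->
  horner_mx L (Xprod s) *m X = 0 ->
  exists a C : R, 0 < a /\
    forall k : nat, mxnorm1 (L ^+ k *m X) <= C * expR (- a * k%:R).
Proof.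
move=> /normc_lt1_expR[a a0 sa] /(power_decay_roots (expR_gt0 _) sa)[C HC].
by exists a, C; split=> // k; rewrite [- a * _]mulrC expRM_natl.
Qed.

(** Each factor obeys [L^-1 - z^-1 = - z^-1 L^-1 (L - z)], and everything in sight commutes. Thus
    whatever is annihilated by a product of factors at [L] is annihilated by the product with
    inverted roots at [L^-1]. *)
Lemma horner_invmx_factor L (s : seq R[i]) :
  L \in unitmx -> 0 \notin s ->
  exists N : 'M[R[i]]_n.+1,
    horner_mx (invmx L) (Xprod [seq z^-1 | z <- s]) =
    N *m horner_mx L (Xprod s).
Proof.
move=> uL; elim: s => [_|z s IH].
  by exists 1%:M; rewrite !big_nil !rmorph1 mul1mx.
rewrite inE negb_or eq_sym => /andP[z0 /IH[N HN]].
exists (- z^-1 *: (N *m invmx L)).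
rewrite map_cons !big_cons mulrC rmorphM /= HN [in RHS]rmorphM !rmorphB /=.
rewrite !horner_mx_X !horner_mx_C -!mulmxE.
have cH : comm_mx (horner_mx L (Xprod s)) (invmx L *m (L - z%:M)).
  apply: comm_horner_mx; apply: comm_mxM.
    by rewrite /comm_mx mulmxV// mulVmx.
  by apply: comm_mxB; [exact: comm_mx_refl|exact: comm_mx_scalar].
have -> : invmx L - z^-1%:M = - z^-1 *: (invmx L *m (L - z%:M)).
  rewrite mulmxBr mulVmx// mul_mx_scalar scalerBr scalerA mulNr mulVf//.
  by rewrite scaleN1r opprK scaleNr scalemx1 addrC.
by rewrite -scalemxAr -!scalemxAl -!mulmxA cH !mulmxA.
Qed.

(* The Riesz projection onto the part of the spectrum inside the unit disc, from a
   Bezout relation between the two factors of [char_poly L]; being a polynomial in [L], it commutes with all that commutes with [L]. *)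
Lemma dichotomic_projection L : L \in unitmx -> dichotomic L ->
  exists p : {poly R[i]}, let P := horner_mx L p in
  [/\ P *m P = P,
      exists a C : R, 0 < a /\
        forall k : nat, mxnorm1 (L ^+ k *m P) <= C * expR (- a * k%:R) &
      exists a C : R, 0 < a /\ forall k : nat,
        mxnorm1 (invmx L ^+ k *m (1%:M - P)) <= C * expR (- a * k%:R)].
Proof.
move=> uL dL.
have [r] := closed_field_poly_normal (char_poly L).
rewrite (monicP (char_poly_monic L)) scale1r => rE.
have r1 z : z \in r -> normc z != 1.
  rewrite -root_prod_XsubC -rE -eigenvalue_root_char => /dL.
  by apply: contra_neq => z1; rewrite normc_def; case: (z) z1 => u v /= ->.
have r0 : 0 \notin r.
  rewrite -root_prod_XsubC -rE -eigenvalue_root_char.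
  apply/negP => /eigenvalueP[v]; rewrite scale0r => vL /negP[].
  by rewrite -(mulmxK uL v) vL mul0mx.
pose s1 := [seq z <- r | normc z < 1]; pose s2 := [seq z <- r | 1 < normc z].
have CH : Xprod s1 * Xprod s2 = char_poly L.
  rewrite rE !big_filter [RHS](bigID (fun z => normc z < 1))/=; congr (_ * _).
  rewrite [RHS]big_seq_cond [LHS]big_seq_cond; apply: eq_bigl => z.
  case zr: (z \in r) => //=; have := r1 _ zr; by case: ltgtP.
have cop : coprimep (Xprod s1) (Xprod s2).
  apply/(@Pdiv.ClosedField.coprimepP R[i]) => z.
  rewrite !root_prod_XsubC !mem_filter => /andP[z1 _].
  by rewrite -[_ != 0]/(~~ root _ _) root_prod_XsubC mem_filter ltNge (ltW z1).
have [[u v] /= uv1] := Bezout_eq1_coprimepP _ _ cop.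
have P1 : 1%:M - horner_mx L (v * Xprod s2) = horner_mx L (u * Xprod s1).
  by apply/eqP; rewrite subr_eq -rmorphD /= uv1 (rmorph1 (horner_mx L)).
have ann w : horner_mx L (w * (Xprod s1 * Xprod s2)) = 0.
  by rewrite CH rmorphM /= Cayley_Hamilton mulr0.
(* Write [c1], [c2] for the two factors and [u c1 + v c2 = 1]. Then [P = (v c2)(L)] and
   [I - P = (u c1)(L)], so [(I - P) P], [c1(L) P] and [c2(L) (I - P)] are all multiples of
   [(c1 c2)(L) = 0] by Cayley-Hamilton. *)
exists (v * Xprod s2) => /=; split.
- apply/eqP; rewrite eq_sym -subr_eq0 -{1}[horner_mx L _]mul1mx -mulmxBl P1.
  rewrite mulmxE -rmorphM -(ann (u * v)); apply/eqP; congr (horner_mx L _); ring.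
- apply: (@power_decay _ _ _ s1) => [z|]; first by rewrite mem_filter => /andP[].
  by rewrite mulmxE -rmorphM -(ann v) /=; congr (horner_mx L _); ring.
(* The roots outside the unit circle become, once inverted, roots inside it for [L^-1]. *)
- apply: (@power_decay _ _ _ [seq z^-1 | z <- s2]) => [z /mapP[w]|].
    rewrite mem_filter => /andP[w1 _] ->.
    by rewrite Normc.normcV invf_lt1// (lt_trans _ w1).
  have [|N ->] := @horner_invmx_factor L s2 uL.
    by rewrite mem_filter (negPf r0) andbF.
  rewrite -mulmxA P1 (_ : horner_mx L _ *m _ = 0) ?mulmx0//.
  by rewrite mulmxE -rmorphM -(ann u) /=; congr (horner_mx L _); ring.
Qed.

End PowerDecay.

(** * Entrywise continuity *)

Section EntrywiseContinuity.
Variable R : realType.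

(** By conversion [mx_continuous F] says this of every entry of [F]; the foldings
    [-/(Rc_continuous _)] below rely on it. *)
Definition Rc_continuous (f : R -> R[i]) : Prop :=
  continuous (fun t => complex.Re (f t)) /\
  continuous (fun t => complex.Im (f t)).

Lemma Rc_continuous_cst (z : R[i]) : Rc_continuous (fun=> z).
Proof. by split=> t; exact: cvg_cst. Qed.

Lemma Rc_continuousD f g : Rc_continuous f -> Rc_continuous g ->
  Rc_continuous (fun t => f t + g t).
Proof.
move=> [f1 f2] [g1 g2]; split=> t.
  rewrite (_ : (fun t => _) = (fun t => complex.Re (f t) + complex.Re (g t))).
    exact: (continuousD (f1 t) (g1 t)).
  by apply/funext => u; case: (f u) (g u) => [a b] [c d].
rewrite (_ : (fun t => _) = (fun t => complex.Im (f t) + complex.Im (g t))).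
  exact: (continuousD (f2 t) (g2 t)).
by apply/funext => u; case: (f u) (g u) => [a b] [c d].
Qed.

Lemma Rc_continuousM f g : Rc_continuous f -> Rc_continuous g ->
  Rc_continuous (fun t => f t * g t).
Proof.
move=> [f1 f2] [g1 g2]; split=> t.
  rewrite (_ : (fun t => _) = (fun t => complex.Re (f t) * complex.Re (g t)
      - complex.Im (f t) * complex.Im (g t))).
    exact: (continuousB (continuousM (f1 t) (g1 t)) (continuousM (f2 t) (g2 t))).
  by apply/funext => u; case: (f u) (g u) => [a b] [c d].
rewrite (_ : (fun t => _) = (fun t => complex.Re (f t) * complex.Im (g t)
    + complex.Im (f t) * complex.Re (g t))).
  exact: (continuousD (continuousM (f1 t) (g2 t)) (continuousM (f2 t) (g1 t))).
by apply/funext => u; case: (f u) (g u) => [a b] [c d].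
Qed.

(** The inverse is the conjugate divided by the squared modulus, whose denominator never
    vanishes. *)
Lemma Rc_continuousV f : Rc_continuous f -> (forall t, f t != 0) ->
  Rc_continuous (fun t => (f t)^-1).
Proof.
move=> [f1 f2] f0.
have n0 t : complex.Re (f t) ^+ 2 + complex.Im (f t) ^+ 2 != 0.
  rewrite paddr_eq0 ?sqr_ge0// !sqrf_eq0.
  by have := f0 t; rewrite eq_complex.
have nc : continuous (fun t =>
    (complex.Re (f t) ^+ 2 + complex.Im (f t) ^+ 2)^-1).
  move=> t; apply: (@continuousV _ _ (fun t => complex.Re (f t) ^+ 2 + complex.Im (f t) ^+ 2) t) => //.
  exact: (continuousD (continuousM (f1 t) (f1 t)) (continuousM (f2 t) (f2 t))).
split=> t.
  rewrite (_ : (fun t => _) = (fun t => complex.Re (f t) *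
    (complex.Re (f t) ^+ 2 + complex.Im (f t) ^+ 2)^-1)).
    by apply: cvgM; [exact: f1|exact: nc].
  by apply/funext => u; case: (f u).
rewrite (_ : (fun t => _) = (fun t => - (complex.Im (f t) *
  (complex.Re (f t) ^+ 2 + complex.Im (f t) ^+ 2)^-1))).
  by apply: cvgN; apply: cvgM; [exact: f2|exact: nc].
by apply/funext => u; case: (f u).
Qed.

Lemma Rc_continuous_sum (I : Type) (r : seq I) (F : I -> R -> R[i]) :
  (forall i, Rc_continuous (F i)) ->
  Rc_continuous (fun t => \sum_(i <- r) F i t).
Proof.
move=> cF; elim: r => [|i r IH].
  rewrite (_ : (fun t => _) = fun=> 0); first exact: Rc_continuous_cst.
  by apply/funext => t; rewrite big_nil.
rewrite (_ : (fun t => _) = fun t => F i t + \sum_(i <- r) F i t).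
  exact: Rc_continuousD.
by apply/funext => t; rewrite big_cons.
Qed.

Lemma Rc_continuous_prod (I : Type) (r : seq I) (F : I -> R -> R[i]) :
  (forall i, Rc_continuous (F i)) ->
  Rc_continuous (fun t => \prod_(i <- r) F i t).
Proof.
move=> cF; elim: r => [|i r IH].
  rewrite (_ : (fun t => _) = fun=> 1); first exact: Rc_continuous_cst.
  by apply/funext => t; rewrite big_nil.
rewrite (_ : (fun t => _) = fun t => F i t * \prod_(i <- r) F i t).
  exact: Rc_continuousM.
by apply/funext => t; rewrite big_cons.
Qed.

Lemma continuous_normc f : Rc_continuous f -> continuous (fun t => normc (f t)).
Proof.
move=> [f1 f2] t.
rewrite (_ : (fun t => _) = Num.sqrt \o
  (fun t => complex.Re (f t) ^+ 2 + complex.Im (f t) ^+ 2)).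
  apply: continuous_comp; last exact: sqrt_continuous.
  exact: (continuousD (continuousM (f1 t) (f1 t)) (continuousM (f2 t) (f2 t))).
by apply/funext => u /=; case: (f u).
Qed.

Lemma mx_continuous_cst m n (X : 'M[R[i]]_(m, n)) : mx_continuous (fun=> X).
Proof. by move=> i j; exact: Rc_continuous_cst. Qed.

Lemma mx_continuousM m n p (F : R -> 'M[R[i]]_(m, n)) (G : R -> 'M[R[i]]_(n, p)) :
  mx_continuous F -> mx_continuous G -> mx_continuous (fun t => F t *m G t).
Proof.
move=> cF cG i j; rewrite -/(Rc_continuous (fun t => (F t *m G t) i j)).
under eq_fun do rewrite mxE.
by apply: Rc_continuous_sum => k; apply: Rc_continuousM; [exact: cF|exact: cG].
Qed.

Lemma mx_continuousZ m n (f : R -> R[i]) (F : R -> 'M[R[i]]_(m, n)) :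
  Rc_continuous f -> mx_continuous F -> mx_continuous (fun t => f t *: F t).
Proof.
move=> cf cF i j; rewrite -/(Rc_continuous (fun t => (f t *: F t) i j)).
under eq_fun do rewrite mxE.
by apply: Rc_continuousM => //; exact: cF.
Qed.

Lemma Rc_continuous_det n (F : R -> 'M[R[i]]_n) :
  mx_continuous F -> Rc_continuous (fun t => \det (F t)).
Proof.
move=> cF; rewrite /determinant; apply: Rc_continuous_sum => s.
apply: Rc_continuousM; first exact: Rc_continuous_cst.
by apply: Rc_continuous_prod => i; exact: cF.
Qed.

(** Cramer's formula: the inverse is the adjugate over the determinant, and the cofactors are again
    determinants of continuous matrices. *)
Lemma mx_continuous_invmx n (F : R -> 'M[R[i]]_n) :
  mx_continuous F -> (forall t, F t \in unitmx) ->
  mx_continuous (fun t => invmx (F t)).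
Proof.
move=> cF uF; rewrite (_ : (fun t => _) = fun t => (\det (F t))^-1 *: \adj (F t)).
  apply: mx_continuousZ.
    apply: Rc_continuousV => [|t]; first exact: Rc_continuous_det.
    by have := uF t; rewrite unitmxE unitfE.
  move=> i j; rewrite -/(Rc_continuous (fun t => (\adj (F t)) i j)).
  under eq_fun do rewrite mxE /cofactor.
  apply: Rc_continuousM; first exact: Rc_continuous_cst.
  apply: Rc_continuous_det => k l.
  rewrite -/(Rc_continuous (fun t => (row' j (col' i (F t))) k l)).
  by under eq_fun do rewrite !mxE; exact: cF.
by apply/funext => t; rewrite /invmx uF.
Qed.

Lemma Rc_continuous_cis (mu : R) : Rc_continuous (fun s => cis (mu * s)).
Proof.
split=> t /=; apply: (@continuous_comp _ _ _ (fun s : R => mu * s)).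
- by apply: cvgM; [exact: cvg_cst|exact: cvg_id].
- exact: continuous_cos.
- by apply: cvgM; [exact: cvg_cst|exact: cvg_id].
- exact: continuous_sin.
Qed.

Lemma mxnorm1_bounded_itv m n (F : R -> 'M[R[i]]_(m, n)) (a b : R) :
  mx_continuous F -> a <= b ->
  exists K : R, forall t, t \in `[a, b] -> mxnorm1 (F t) <= K.
Proof.
move=> cF ab.
have cN : continuous (fun t => mxnorm1 (F t)).
  rewrite /mxnorm1; apply: continuous_big => [|i _]; first exact: add_continuous.
  apply: continuous_big => [|j _]; first exact: add_continuous.
  by apply: continuous_normc; exact: cF.
have [c _ cM] := EVT_max ab (continuous_subspaceT cN).
by exists (mxnorm1 (F c)).
Qed.

End EntrywiseContinuity.

(** * Linear differential equations *)

Section LinearODE.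
Variable R : realType.

Lemma is_derive_bigsum n (f : 'I_n -> R -> R) (df : 'I_n -> R) (t : R) :
  (forall i, is_derive t 1 (f i) (df i)) ->
  is_derive t 1 (fun s => \sum_i f i s) (\sum_i df i).
Proof. by move=> fd; rewrite -fct_sumE; exact: is_derive_sum. Qed.

(* The exponential weight [expR (c t)] makes [g] monotone: nonincreasing for
   [c = -K], nondecreasing for [c = K]. *)
Lemma gronwall_zero (g dg : R -> R) (K a b : R) : a <= b ->
  (forall t : R, is_derive t 1 g (dg t)) -> (forall t, 0 <= g t) ->
  (forall t, t \in `]a, b[ -> `|dg t| <= K * g t) ->
  (g a = 0 <-> g b = 0).
Proof.
move=> ab gd g0 dgK.
pose h (c t : R) := g t * expR (c * t).
have hd (c t : R) : is_derive t 1 (h c) ((dg t + c * g t) * expR (c * t)).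
  have ed : is_derive t 1 (expR \o ( *%R c)) (expR (c * t) * c).
    apply: is_derive1_comp.
    by apply: is_derive_eq; rewrite /= ?mulr0 ?addr0 ?scaler0 ?add0r //; exact: mulr1.
  have hE : h c = (g : R -> R) * (expR \o ( *%R c)) by [].
  rewrite hE; apply: (is_derive_eq (is_deriveM (gd t) ed)).
  by rewrite /GRing.scale/=; ring.
have hD (c t : R) : derivable (h c) t 1 by case: (hd c t).
have h1 c t : (h c)^`()%classic t = (dg t + c * g t) * expR (c * t).
  by rewrite derive1E; apply: derive_val.
have hC c : {within `[a, b], continuous (h c)}.
  by apply: derivable_within_continuous => t _; exact: hD.
split=> g00; apply/eqP; rewrite eq_le g0 andbT.
  have : h (- K) b <= h (- K) a.
    apply: (@ler0_derive1_nincr _ _ a b) => // t tab.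
    rewrite h1 pmulr_lle0 ?expR_gt0// mulNr subr_le0.
    exact: le_trans (ler_norm _) (dgK _ tab).
  by rewrite /h g00 mul0r pmulr_lle0 ?expR_gt0.
have : h K a <= h K b.
  apply: (@ger0_derive1_ndecr _ _ a b) => // t tab.
  rewrite h1 pmulr_lge0 ?expR_gt0// -lerBlDr sub0r.
  by have := dgK _ tab; rewrite ler_norml => /andP[].
by rewrite /h g00 mul0r pmulr_lle0 ?expR_gt0.
Qed.

(** Energy argument: the sum [g] of the squared moduli of the entries of [Y] satisfies [|g'| <= c g]
    on each compact interval, where [A] is bounded. Gronwall then carries the zero of [g] at [t0]
    both forwards and backwards in time. *)
Lemma linear_ode_eq0 m p (A : R -> 'M[R[i]]_m) (Y : R -> 'M[R[i]]_(m, p)) t0 :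
  mx_continuous A -> (forall t, mx_has_derivative Y t (A t *m Y t)) ->
  Y t0 = 0 -> forall t, Y t = 0.
Proof.
move=> cA dY Y0.
pose g t := \sum_i \sum_j
  (complex.Re (Y t i j) ^+ 2 + complex.Im (Y t i j) ^+ 2).
pose w t := A t *m Y t.
pose dg t := \sum_i \sum_j 2 * (complex.Re (Y t i j) * complex.Re (w t i j) +
  complex.Im (Y t i j) * complex.Im (w t i j)).
have s0 (z : R[i]) : 0 <= complex.Re z ^+ 2 + complex.Im z ^+ 2.
  by rewrite addr_ge0 ?sqr_ge0.
have gd (t : R) : is_derive t 1 g (dg t).
  apply: is_derive_bigsum => i; apply: is_derive_bigsum => j.
  have [d1 d2] := dY t i j.
  apply: (is_derive_eq (is_deriveD (is_deriveX 2 d1) (is_deriveX 2 d2))).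
  by rewrite /GRing.scale/= -/(w t) !expr1; ring.
have g0 t : 0 <= g t by apply: sumr_ge0 => i _; apply: sumr_ge0.
have normY t i j : normc (Y t i j) <= Num.sqrt (g t).
  rewrite (_ : normc _ = Num.sqrt
    (complex.Re (Y t i j) ^+ 2 + complex.Im (Y t i j) ^+ 2)); last by case: (Y t i j).
  rewrite ler_sqrt// /g (bigD1 i)//= (bigD1 j)//= -addrA lerDl addr_ge0//.
    by apply: sumr_ge0.
  by apply: sumr_ge0 => k _; apply: sumr_ge0.
have main a b : a <= b -> (g a = 0 <-> g b = 0).
  move=> ab; have [K AK] := mxnorm1_bounded_itv cA ab.
  (* Each of the [m p] terms of [dg] is twice a sum of two products, each product being at most
     [sqrt g * (K * sqrt g) = K g]; hence [4 K] per entry. *)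
  apply: (@gronwall_zero g dg (4 * K *+ p *+ m) a b) => // t tab.
  have {}tab : t \in `[a, b] by move: tab; exact: subset_itv_oo_cc.
  have wK i j : normc (w t i j) <= K * Num.sqrt (g t).
    rewrite mxE; apply: le_trans (ler_normc_sum _) _.
    apply: (@le_trans _ _ (mxnorm1 (A t) * Num.sqrt (g t))); last first.
      by rewrite ler_wpM2r ?sqrtr_ge0 ?AK.
    apply: (@le_trans _ _ ((\sum_k normc (A t i k)) * Num.sqrt (g t))).
      rewrite mulr_suml; apply: ler_sum => k _.
      by rewrite Normc.normcM ler_wpM2l ?normc_ge0.
    rewrite ler_wpM2r ?sqrtr_ge0// /mxnorm1 [leRHS](bigD1 i)//= lerDl.
    by do 2![apply: sumr_ge0 => ? _]; exact: normc_ge0.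
  have prod_le (x y u v : R) : `|x| <= u -> `|y| <= v -> `|x * y| <= u * v.
    by move=> xu yv; rewrite normrM ler_pM.
  have e : 4 * K *+ p *+ m * g t =
      \sum_(i < m) \sum_(j < p) 4 * (Num.sqrt (g t) * (K * Num.sqrt (g t))).
    by rewrite !sumr_const !card_ord -[in LHS](sqr_sqrtr (g0 t)); ring.
  rewrite e; apply: le_trans (ler_norm_sum _ _ _) _; apply: ler_sum => i _.
  apply: le_trans (ler_norm_sum _ _ _) _; apply: ler_sum => j _.
  rewrite normrM (ger0_norm (ler0n _ 2)).
  have := ler_normD (complex.Re (Y t i j) * complex.Re (w t i j))
                    (complex.Im (Y t i j) * complex.Im (w t i j)).
  have := prod_le _ _ _ _ (le_trans (normr_Re_le _) (normY t i j))
                          (le_trans (normr_Re_le _) (wK i j)).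
  have := prod_le _ _ _ _ (le_trans (normr_Im_le _) (normY t i j))
                          (le_trans (normr_Im_le _) (wK i j)).
  lra.
have gt0 : g t0 = 0.
  by rewrite /g Y0 big1// => i _; rewrite big1// => j _; rewrite mxE expr0n addr0.
move=> t; have gt : g t = 0.
  by case: (leP t0 t) => [/main|/ltW/main] [H1 H2]; [exact: H1|exact: H2].
apply/matrixP => i j; rewrite mxE; apply: Normc.eq0_normc; apply/eqP.
by rewrite eq_le normc_ge0 andbT (le_trans (normY t i j))// gt sqrtr0.
Qed.

Lemma mx_has_derivativeMr m n p (F : R -> 'M[R[i]]_(m, n)) t D
    (X : 'M[R[i]]_(n, p)) :
  mx_has_derivative F t D -> mx_has_derivative (fun s => F s *m X) t (D *m X).
Proof.
move=> dF i j.
(* The constant entries of [X] stand on the left, so that each summand is a scalar multiple in the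
   sense of [is_deriveZ]. *)
have ReE (G : 'M[R[i]]_(m, n)) : complex.Re ((G *m X) i j) =
   \sum_k (complex.Re (X k j) * complex.Re (G i k) -
           complex.Im (X k j) * complex.Im (G i k)).
  rewrite mxE; elim/big_ind2: _ => [//|x a y b <- <-|k _]; first by rewrite ReD.
  by case: (G i k) (X k j) => [a b] [c d] /=; ring.
have ImE (G : 'M[R[i]]_(m, n)) : complex.Im ((G *m X) i j) =
   \sum_k (complex.Re (X k j) * complex.Im (G i k) +
           complex.Im (X k j) * complex.Re (G i k)).
  rewrite mxE; elim/big_ind2: _ => [//|x a y b <- <-|k _]; first by rewrite ImD.
  by case: (G i k) (X k j) => [a b] [c d] /=; ring.
split.
  under eq_fun do rewrite ReE; rewrite ReE.
  apply: is_derive_bigsum => k; have [d1 d2] := dF i k.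
  exact: (is_deriveB (is_deriveZ _ d1) (is_deriveZ _ d2)).
under eq_fun do rewrite ImE; rewrite ImE.
apply: is_derive_bigsum => k; have [d1 d2] := dF i k.
exact: (is_deriveD (is_deriveZ _ d2) (is_deriveZ _ d1)).
Qed.

Lemma mx_has_derivativeB m n (F G : R -> 'M[R[i]]_(m, n)) t D E :
  mx_has_derivative F t D -> mx_has_derivative G t E ->
  mx_has_derivative (fun s => F s - G s) t (D - E).
Proof.
move=> dF dG i j; have [F1 F2] := dF i j; have [G1 G2] := dG i j.
have ReB (X Y : 'M[R[i]]_(m, n)) :
    complex.Re ((X - Y) i j) = complex.Re (X i j) - complex.Re (Y i j).
  by rewrite !mxE; case: (X i j) => a b; case: (Y i j).
have ImB (X Y : 'M[R[i]]_(m, n)) :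
    complex.Im ((X - Y) i j) = complex.Im (X i j) - complex.Im (Y i j).
  by rewrite !mxE; case: (X i j) => a b; case: (Y i j).
split.
  by under eq_fun do rewrite ReB; rewrite ReB; exact: is_deriveB.
by under eq_fun do rewrite ImB; rewrite ImB; exact: is_deriveB.
Qed.

Lemma mx_has_derivative_continuous m n (F DF : R -> 'M[R[i]]_(m, n)) :
  (forall t, mx_has_derivative F t (DF t)) -> mx_continuous F.
Proof.
move=> dF i j; split=> t; have [[d1 _] [d2 _]] := dF t i j;
  apply: differentiable_continuous; exact/derivable1_diffP.
Qed.

(** * Fundamental solutions: invertibility, uniqueness and Floquet's relation *)

Section FundamentalSolution.
Variables (m : nat) (A Phi : R -> 'M[R[i]]_m).
Hypotheses (cA : mx_continuous A) (fPhi : fundamental_solution A Phi).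

(** With [t] fixed, [Phi s *m cokermx (Phi t)] solves the equation in [s] and vanishes at [s = t],
    hence also at [s = 0], where it is the cokernel matrix itself. *)
Lemma fundamental_solution_unitmx t : Phi t \in unitmx.
Proof.
have [dPhi Phi0] := fPhi.
rewrite -row_full_unit -cokermx_eq0; apply/eqP.
rewrite -[LHS]mul1mx -Phi0.
apply: (@linear_ode_eq0 _ _ A (fun s => Phi s *m cokermx (Phi t)) t) => //.
  by move=> s; rewrite mulmxA; exact: mx_has_derivativeMr.
exact: mulmx_coker.
Qed.

(** The difference of the two sides solves the same linear equation and vanishes at 0. *)
Lemma fundamental_solution_uniq n (Y : R -> 'M[R[i]]_(m, n)) :
  (forall t, mx_has_derivative Y t (A t *m Y t)) ->
  forall t, Y t = Phi t *m Y 0.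
Proof.
have [dPhi Phi0] := fPhi.
move=> dY t; apply/eqP; rewrite -subr_eq0; apply/eqP.
apply: (@linear_ode_eq0 _ _ A (fun s => Y s - Phi s *m Y 0) 0) => //.
  move=> s; rewrite mulmxBr mulmxA; apply: mx_has_derivativeB => //.
  exact: mx_has_derivativeMr.
by rewrite Phi0 mul1mx subrr.
Qed.

Lemma fundamental_solution_continuous : mx_continuous Phi.
Proof. by case: fPhi => dPhi _; exact: mx_has_derivative_continuous dPhi. Qed.

(** By periodicity of [A] the translate [s |-> Phi (s + q)] solves the same equation, with value
    [Phi q] at 0. *)
Lemma fundamental_solution_shift (q : R) : (forall t, A (t + q) = A t) ->
  forall t, Phi (t + q) = Phi t *m Phi q.
Proof.
have [dPhi Phi0] := fPhi.
move=> Aq t; rewrite -{2}[q]add0r.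
apply: (@fundamental_solution_uniq _ (fun s => Phi (s + q))) => s i j.
have [d1 d2] := dPhi (s + q) i j; rewrite -Aq.
have sd : is_derive s 1 (fun u : R => u + q) 1 by exact: is_derive_shift.
split; rewrite -[X in is_derive _ _ _ X]mulr1.
  exact: (@is_derive1_comp _ _ (fun u : R => u + q) s _ _ d1 sd).
exact: (@is_derive1_comp _ _ (fun u : R => u + q) s _ _ d2 sd).
Qed.

End FundamentalSolution.
End LinearODE.

(** * Entrywise integrals *)

Section EntrywiseIntegral.
Variable R : realType.
Local Notation mu := (@lebesgue_measure R).

Lemma integrable_itv (f : R -> R) (t : R) :
  continuous f -> mu.-integrable `[0, t] (EFin \o f).
Proof.
move=> cf; apply: continuous_compact_integrable; first exact: segment_compact.
exact: continuous_subspaceT.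
Qed.

(** The scalar form of [mx_integral], convertible to each of its entries. *)
Definition Rc_integral (f : R -> R[i]) (t : R) : R[i] :=
  Complex (Rintegral mu `[0, t] (fun s => complex.Re (f s)))
          (Rintegral mu `[0, t] (fun s => complex.Im (f s))).

Lemma Rc_integralD f g t : Rc_continuous f -> Rc_continuous g ->
  Rc_integral (fun s => f s + g s) t = Rc_integral f t + Rc_integral g t.
Proof.
move=> [f1 f2] [g1 g2]; rewrite /Rc_integral.
under eq_Rintegral do rewrite ReD.
under [in X in Complex _ X]eq_Rintegral do rewrite ImD.
by rewrite !RintegralD//; exact: integrable_itv.
Qed.

Lemma Rc_integralZ (z : R[i]) f t : Rc_continuous f ->
  Rc_integral (fun s => z * f s) t = z * Rc_integral f t.
Proof.
move=> [f1 f2]; rewrite /Rc_integral.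
under eq_Rintegral do rewrite ReM.
under [in X in Complex _ X]eq_Rintegral do rewrite ImM.
have cZ (c : R) (h : R -> R) : continuous h -> continuous (fun s => c * h s).
  by move=> ch s; apply: cvgM; [exact: cvg_cst|exact: ch].
rewrite RintegralB ?RintegralD//; try by apply: integrable_itv; exact: cZ.
rewrite !RintegralZl//; try exact: integrable_itv.
by case: z.
Qed.

Lemma Rc_integral_sum n (F : 'I_n -> R -> R[i]) t :
  (forall i, Rc_continuous (F i)) ->
  Rc_integral (fun s => \sum_i F i s) t = \sum_i Rc_integral (F i) t.
Proof.
move=> cF; elim: n F cF => [|n IH] F cF.
  rewrite big_ord0 /Rc_integral.
  under eq_Rintegral do rewrite big_ord0.
  under [in X in Complex _ X]eq_Rintegral do rewrite big_ord0.
  by rewrite !Rintegral_cst// mul0r.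
rewrite big_ord_recl -IH// -Rc_integralD//; last exact: Rc_continuous_sum.
by congr Rc_integral; apply/funext => s; rewrite big_ord_recl.
Qed.

Lemma mx_integral_mull m n p (P : 'M[R[i]]_(m, n)) (F : R -> 'M[R[i]]_(n, p)) t :
  mx_continuous F ->
  P *m mx_integral F t = mx_integral (fun s => P *m F s) t.
Proof.
move=> cF; apply/matrixP => i j; rewrite [RHS]mxE.
rewrite -/(Rc_integral (fun s => (P *m F s) i j) t).
under eq_fun do rewrite mxE.
rewrite Rc_integral_sum => [|k]; last first.
  by apply: Rc_continuousM; [exact: Rc_continuous_cst|exact: cF].
by rewrite mxE; apply: eq_bigr => k _; rewrite mxE Rc_integralZ//; exact: cF.
Qed.

Lemma mx_integral_mulr m n p (F : R -> 'M[R[i]]_(m, n)) (P : 'M[R[i]]_(n, p)) t :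
  mx_continuous F ->
  mx_integral F t *m P = mx_integral (fun s => F s *m P) t.
Proof.
move=> cF; apply/matrixP => i j; rewrite [RHS]mxE.
rewrite -/(Rc_integral (fun s => (F s *m P) i j) t).
under eq_fun do rewrite mxE.
under eq_fun do under eq_bigr do rewrite mulrC.
rewrite Rc_integral_sum => [|k]; last first.
  by apply: Rc_continuousM; [exact: Rc_continuous_cst|exact: cF].
by rewrite mxE; apply: eq_bigr => k _; rewrite mxE Rc_integralZ 1?mulrC//; exact: cF.
Qed.

(** A constant factor passes through the integral on either side. This is how a matrix commuting
    with every [Phi s] is seen to commute with [Phi_mu] and [Psi_mu]. *)
Lemma comm_mx_integral n (P : 'M[R[i]]_n) (F : R -> 'M[R[i]]_n) t :
  mx_continuous F -> (forall s, comm_mx P (F s)) -> comm_mx P (mx_integral F t).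
Proof.
move=> cF PF; rewrite /comm_mx mx_integral_mull// mx_integral_mulr//.
by congr mx_integral; apply/funext => s; exact: PF.
Qed.

(** The majorant has primitive [G s = (K / a) e^(-a (t - s))], so its integral is
    [(K / a) (1 - e^(-a t))], at most [K / a] uniformly in [t]. *)
Lemma normr_integral_le_expR (f : R -> R) (K a t : R) : 0 < a -> 0 <= t ->
  continuous f ->
  (forall s, 0 <= s <= t -> `|f s| <= K * expR (- a * (t - s))) ->
  `|Rintegral mu `[0, t] f| <= K / a.
Proof.
move=> a0; rewrite le_eqVlt => /predU1P[<-|t0] cf fK.
  (* For [t = 0] the fundamental theorem of calculus has no proper interval to work on. The integral
     is then zero, and the hypothesis at [s = 0] yields [0 <= K]. *)
  rewrite set_itv1 Rintegral_set1 normr0 divr_ge0 ?(ltW a0)//.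
  have := fK 0; rewrite lexx subrr mulr0 expR0 mulr1 => /(_ isT).
  exact: le_trans.
pose G s := K / a * expR (- a * (t - s)).
have Gd (s : R) : is_derive s 1 G (K * expR (- a * (t - s))).
  have ld : is_derive s 1 (fun u : R => - a * (t - u)) a.
    rewrite (_ : (fun u => _) = (fun u => a * u - a * t)); last first.
      by apply/funext => u; ring.
    apply: (is_derive_eq (is_deriveB (is_deriveZ a (is_derive_id s (1 : R)))
                                     (is_derive_cst (a * t) s 1))).
    by rewrite subr0 [_ *: _]mulr1.
  have ed := @is_derive1_comp _ _ (fun u : R => - a * (t - u)) s _ _ (is_derive_expR _) ld.
  apply: (is_derive_eq (is_deriveZ (K / a) ed)).
  by rewrite /GRing.scale/=; field; rewrite gt_eqF.
(* The integrand is [a * G], so it inherits continuity from the differentiability of [G]. *)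
have cE : continuous (fun s => K * expR (- a * (t - s))).
  have -> : (fun s => K * expR (- a * (t - s))) = (fun s => a * G s).
    by apply/funext => s; rewrite /G; field; rewrite gt_eqF.
  move=> s; apply: cvgM; first exact: cvg_cst.
  apply: differentiable_continuous; apply/derivable1_diffP.
  by case: (Gd s).
have FTC : Rintegral mu `[0, t] (fun s => K * expR (- a * (t - s))) = G t - G 0.
  rewrite /Rintegral (@continuous_FTC2 _ _ G)//=.
  - exact: continuous_subspaceT.
  - split=> [s _||]; first by case: (Gd s).
      apply: cvg_at_right_filter; apply: differentiable_continuous.
      by apply/derivable1_diffP; case: (Gd 0).
    apply: cvg_at_left_filter; apply: differentiable_continuous.
    by apply/derivable1_diffP; case: (Gd t).
  - by move=> s _; rewrite derive1E; apply: derive_val.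
apply: le_trans (le_normr_Rintegral _ _) _ => //; first exact: integrable_itv.
apply: (@le_trans _ _ (G t - G 0)).
  rewrite -FTC; apply: le_Rintegral => //.
  - by apply: integrable_itv => s; apply: cvg_norm; exact: cf.
  - exact: integrable_itv.
have K0 : 0 <= K.
  have := fK t; rewrite lexx (ltW t0) subrr mulr0 expR0 mulr1 => /(_ isT).
  exact: le_trans.
rewrite /G subrr mulr0 expR0 mulr1 lerBlDr lerDl mulr_ge0 ?expR_ge0//.
by rewrite divr_ge0// ltW.
Qed.

(** Since [|e^(i nu s)| = 1], the forcing leaves the decay estimate intact whatever the frequency.
    The real and imaginary parts of an entry contribute [K / a] each. *)
Lemma bounded_forced_response m (W : R -> R -> 'M[R[i]]_m) (nu : R)
    (c : 'cV[R[i]]_m) (K a : R) : 0 < a ->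
  (forall t, mx_continuous (W t)) ->
  (forall t s, 0 <= s <= t -> mxnorm1 (W t s *m c) <= K * expR (- a * (t - s))) ->
  bounded_on_nonneg
    (fun t => mx_integral (fun s => W t s *m (cis (nu * s) *: c)) t).
Proof.
move=> a0 cW WK; exists (K / a + K / a) => t t0 i.
rewrite normc_def lecR -[X in X <= _]/(Num.sqrt _).
set z := mx_integral _ _ _ _.
have -> : Num.sqrt (complex.Re z ^+ 2 + complex.Im z ^+ 2) = normc z by case: z.
have cF : Rc_continuous (fun s => (W t s *m (cis (nu * s) *: c)) i 0).
  apply: (mx_continuousM (cW t)); apply: mx_continuousZ.
    exact: Rc_continuous_cis.
  exact: mx_continuous_cst.
have FK s : 0 <= s <= t ->
    normc ((W t s *m (cis (nu * s) *: c)) i 0) <= K * expR (- a * (t - s)).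
  move=> st; apply: le_trans (normc_le_mxnorm1 _ _ _) _.
  rewrite -scalemxAr mxnorm1Z /= cos2Dsin2 sqrtr1 mul1r; exact: WK.
apply: le_trans (normc_le_ReIm _) _; rewrite /z mxE /=.
apply: lerD; apply: normr_integral_le_expR => //; try by case: cF.
  by move=> s /FK; apply: le_trans; exact: normr_Re_le.
by move=> s /FK; apply: le_trans; exact: normr_Im_le.
Qed.

End EntrywiseIntegral.

(** * Periodic systems *)

Section PeriodicSystem.
Variables (R : realType) (n : nat) (q : R) (A Phi : R -> 'M[R[i]]_n.+1).
Hypotheses (q0 : 0 < q) (cA : mx_continuous A) (Aq : forall t, A (t + q) = A t).
Hypothesis (fPhi : fundamental_solution A Phi).
Hypothesis (hcomm : forall t s : R,
  Phi t *m invmx (Phi s) = invmx (Phi s) *m Phi t).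

Lemma poincareE : poincare Phi q = Phi q.
Proof. by rewrite /poincare /evolU fPhi.2 invmx1 mulmx1. Qed.

Let uPhi t : Phi t \in unitmx.
Proof. exact: fundamental_solution_unitmx cA fPhi t. Qed.

(** By [hcomm], conjugation by [Phi s] fixes [Phi t]. Polynomials in [Phi q] therefore commute with
    every [Phi s]. *)
Lemma comm_mx_fundamental t s : comm_mx (Phi t) (Phi s).
Proof.
rewrite /comm_mx -[RHS](mulmxKV (uPhi s)) -[Phi s *m Phi t *m _]mulmxA hcomm.
by rewrite mulKVmx.
Qed.

Lemma fundamental_solution_shiftn t k : Phi (t + k%:R * q) = Phi t *m Phi q ^+ k.
Proof.
elim: k => [|k IH]; first by rewrite mul0r addr0 expr0 mulmx1.
rewrite -natr1 mulrDl mul1r addrA (fundamental_solution_shift cA fPhi Aq) IH.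
by rewrite exprSr mulmxA.
Qed.

(** Here [k] and [k + l] are the integer parts of [s / q] and [t / q]. The remainders lie in
    [[0, q]], so [v - u <= q], which accounts for the extra period in the last bound. *)
Lemma period_decomposition s t : 0 <= s <= t ->
  exists u v : R, exists k l : nat,
  [/\ u \in `[0, q], v \in `[0, q],
      s = u + k%:R * q, t = v + (k + l)%:R * q & t - s <= (l%:R + 1) * q].
Proof.
move=> /andP[s0 st]; have t0 := le_trans s0 st.
have trunc x : 0 <= x -> 0 <= x - (Num.truncn (x / q))%:R * q <= q.
  move=> x0; have /truncn_itv/andP[] : 0 <= x / q by rewrite divr_ge0// ltW.
  rewrite ler_pdivlMr// ltr_pdivrMr// -natr1 mulrDl mul1r => H1 H2.
  by rewrite subr_ge0 H1 lerBlDl ltW.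
have kl : (Num.truncn (s / q) <= Num.truncn (t / q))%N.
  by apply: le_truncn; rewrite ler_pM2r ?invr_gt0.
exists (s - (Num.truncn (s / q))%:R * q), (t - (Num.truncn (t / q))%:R * q).
exists (Num.truncn (s / q)), (Num.truncn (t / q) - Num.truncn (s / q))%N.
rewrite subnKC//; split; rewrite ?in_itv/= ?trunc// ?subrK//.
rewrite natrB//.
have /andP[+ _] := trunc _ s0; have /andP[_] := trunc _ t0; lra.
Qed.

(** Converts decay per period into decay in time: the rate becomes [a / q], and the factor [e^a]
    pays for the incomplete period. *)
Lemma expR_period_le (a x : R) (l : nat) : 0 < a -> x <= (l%:R + 1) * q ->
  expR (- a * l%:R) <= expR a * expR (- (a / q) * x).
Proof.
move=> a0; rewrite -expRD ler_expR -ler_pdivrMr// => xl.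
have : a * (x / q) <= a * (l%:R + 1) by rewrite ler_wpM2l ?(ltW a0).
have -> : - (a / q) * x = - (a * (x / q)) by ring.
lra.
Qed.

Lemma fundamental_solution_bounded : exists2 K : R, 0 <= K &
  forall t, t \in `[0, q] -> mxnorm1 (Phi t) <= K /\ mxnorm1 (invmx (Phi t)) <= K.
Proof.
have cPhi := fundamental_solution_continuous fPhi.
have [K1 H1] := mxnorm1_bounded_itv cPhi (ltW q0).
have [K2 H2] := mxnorm1_bounded_itv (mx_continuous_invmx cPhi uPhi) (ltW q0).
exists (Num.max `|K1| `|K2|); first by rewrite le_max normr_ge0.
move=> t tq; split; rewrite le_max.
  by rewrite (le_trans (H1 t tq) (ler_norm _)).
by rewrite (le_trans (H2 t tq) (ler_norm _)) orbT.
Qed.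

(** * Exponential decay of the projected evolution families *)

Section Decay.
Variables (M P : 'M[R[i]]_n.+1) (W : R -> R -> 'M[R[i]]_n.+1) (a C : R).
Hypothesis a0 : 0 < a.
Hypothesis MP : forall k : nat, mxnorm1 (M ^+ k *m P) <= C * expR (- a * k%:R).

(** The outer factors [Phi u'] and [invmx (Phi v')] are bounded over one period, and the middle one
    decays with the number [l] of periods. The disjunction covers both orders: [(v, u)] with [M = L]
    for [evolU], [(u, v)] with [M = L^-1] for [evolV]. *)
Lemma factored_decay :
  (forall (u v : R) (k l : nat), exists u' v', [/\ 
    (u' = u /\ v' = v) \/ (u' = v /\ v' = u) &
    W (v + (k + l)%:R * q) (u + k%:R * q) *m P =
      Phi u' *m (M ^+ l *m P) *m invmx (Phi v')]) ->
  exists K b : R, 0 < b /\ forall t s, 0 <= s <= t ->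
    mxnorm1 (W t s *m P) <= K * expR (- b * (t - s)).
Proof.
move=> WE; have [K K0 HK] := fundamental_solution_bounded.
exists (K * C * K * expR a), (a / q); split; first by rewrite divr_gt0.
move=> t s /period_decomposition[u [v [k [l [uq vq -> -> le_ts]]]]].
have [u' [v' [uv ->]]] := WE u v k l.
have [[Ku _] [_ Kv]] : (mxnorm1 (Phi u') <= K /\ mxnorm1 (invmx (Phi u')) <= K)
  /\ (mxnorm1 (Phi v') <= K /\ mxnorm1 (invmx (Phi v')) <= K).
  by case: uv => -[-> ->]; split; exact: HK.
have C0 : 0 <= C.
  by have := MP 0; rewrite mulr0 expR0 mulr1; apply: le_trans; exact: mxnorm1_ge0.
apply: (@le_trans _ _ (K * (C * expR (- a * l%:R)) * K)).
  apply: le_trans (mxnorm1M _ _) _; apply: ler_pM; rewrite ?mxnorm1_ge0//.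
  apply: le_trans (mxnorm1M _ _) _; apply: ler_pM; rewrite ?mxnorm1_ge0//.
rewrite -[leRHS]mulrA (_ : K * (C * _) * K = K * C * K * expR (- a * l%:R)).
  by rewrite ler_wpM2l ?mulr_ge0 ?expR_period_le.
ring.
Qed.

End Decay.

(** Floquet's relation gives [U = Phi(v) L^(k+l) L^-k Phi(u)^-1 = Phi(v) L^l Phi(u)^-1], and [P]
    moves to the left past [Phi(u)^-1]. *)
Lemma evolU_decay P a C : 0 < a -> (forall s, comm_mx P (Phi s)) ->
  (forall k : nat, mxnorm1 (Phi q ^+ k *m P) <= C * expR (- a * k%:R)) ->
  exists K b : R, 0 < b /\ forall t s, 0 <= s <= t ->
    mxnorm1 (evolU Phi t s *m P) <= K * expR (- b * (t - s)).
Proof.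
move=> a0 PPhi LP; apply: (factored_decay a0 LP) => u v k l.
exists v, u; split; first by right.
rewrite /evolU !fundamental_solution_shiftn.
have [uu uL] : Phi u \is a GRing.unit /\ Phi q \is a GRing.unit by [].
have invE (X : 'M[R[i]]_n.+1) : invmx X = X^-1 by [].
rewrite !invE !mulmxE invrM ?unitrX// addnC exprD.
rewrite !mulrA mulrK ?unitrX// -!mulrA.
by rewrite (commrV (PPhi u : GRing.comm P _)).
Qed.

(** Here the powers cancel the other way, [V = Phi(u) L^k L^-(k+l) Phi(v)^-1 = Phi(u) L^-l
    Phi(v)^-1], so decay is needed for the powers of [L^-1] on [Q]. *)
Lemma evolV_decay Q a C : 0 < a -> (forall s, comm_mx Q (Phi s)) ->
  (forall k : nat, mxnorm1 (invmx (Phi q) ^+ k *m Q) <= C * expR (- a * k%:R)) ->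
  exists K b : R, 0 < b /\ forall t s, 0 <= s <= t ->
    mxnorm1 (evolV Phi t s *m Q) <= K * expR (- b * (t - s)).
Proof.
move=> a0 QPhi LQ; apply: (factored_decay a0 LQ) => u v k l.
exists u, v; split; first by left.
rewrite /evolV !fundamental_solution_shiftn.
have [uv uL] : Phi v \is a GRing.unit /\ Phi q \is a GRing.unit by [].
have invE (X : 'M[R[i]]_n.+1) : invmx X = X^-1 by [].
rewrite !invE !mulmxE invrM ?unitrX// addnC exprD.
rewrite invrM ?unitrX// !mulrA mulrK ?unitrX// exprVn -!mulrA.
by rewrite (commrV (QPhi v : GRing.comm Q _)).
Qed.

End PeriodicSystem.

Theorem theorem3p2 (R : realType) (q : R) (m : nat)
    (A Phi : R -> 'M[R[i]]_m)
    (hq : 0 < q) (hm : (1 <= m)%N)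
    (hAcont : mx_continuous A)
    (hAper : forall t : R, A (t + q) = A t)
    (hPhi : fundamental_solution A Phi)
    (hcomm : forall t s : R,
       Phi t *m invmx (Phi s) = invmx (Phi s) *m Phi t)
    (hL : dichotomic (poincare Phi q))
    (hP : exists P : 'M[R[i]]_m, commuting_projection Phi q P) :
  exists P : 'M[R[i]]_m,
    commuting_projection Phi q P /\
    forall (mu : R) (b : 'cV[R[i]]_m), b != 0 ->
      bounded_on_nonneg (solU Phi mu (P *m b)) /\
      bounded_on_nonneg (solV Phi mu ((1%:M - P) *m b)).
Proof.
(* A size of the form [n.+1] gives square matrices the ring structure on which [horner_mx] rests. *)
case: m => [//|n] in A Phi hm hAcont hAper hPhi hcomm hL hP *.
have uPhi := fundamental_solution_unitmx hAcont hPhi.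
have cPhi := fundamental_solution_continuous hPhi.
have cVPhi := mx_continuous_invmx cPhi uPhi.
have LE := poincareE q hPhi; rewrite LE in hL.
have [p [P2 [a [C [a0 decU]]] [a' [C' [a'0 decV]]]]] :=
  dichotomic_projection (uPhi q) hL.
set P := horner_mx (Phi q) p in P2 decU decV *.
have PPhi s : comm_mx P (Phi s).
  by apply: comm_horner_mx; exact: comm_mx_fundamental hAcont hPhi hcomm _ _.
have PVPhi s : comm_mx P (invmx (Phi s)) by exact: (commrV (PPhi s)).
have QPhi s : comm_mx (1%:M - P) (Phi s).
  by apply: comm_mx_sym; apply: comm_mxB; [exact: comm_mx1|exact/comm_mx_sym].
have cU t : mx_continuous (evolU Phi t).
  by apply: mx_continuousM => //; exact: mx_continuous_cst.
have cV t : mx_continuous (evolV Phi t).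
  by apply: mx_continuousM => //; exact: mx_continuous_cst.
have Pcis (X : 'M[R[i]]_n.+1) z : comm_mx P X -> comm_mx P (z *: X).
  by move=> PX; rewrite /comm_mx -scalemxAl -scalemxAr PX.
exists P; split.
  split=> //; first by rewrite LE.
  - move=> mu; apply: comm_mx_integral => [|s].
      by apply: mx_continuousZ => //; exact: Rc_continuous_cis.
    by apply: Pcis; apply: comm_mxM.
  - move=> mu; apply: comm_mx_integral => [|s].
      by apply: mx_continuousZ => //; exact: Rc_continuous_cis.
    by apply: Pcis; apply: comm_mxM.
(* Common to both problems, with [S] the projection concerned: [|W S b| <= |W S| |b|], so the vector
   [b] only multiplies the constant by [mxnorm1 b]. *)
have bnd (W : R -> R -> 'M[R[i]]_n.+1) (S : 'M[R[i]]_n.+1) mu (b : 'cV[R[i]]_n.+1) :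
    (forall t, mx_continuous (W t)) ->
    (exists K c : R, 0 < c /\ forall t s, 0 <= s <= t ->
      mxnorm1 (W t s *m S) <= K * expR (- c * (t - s))) ->
    bounded_on_nonneg
      (fun t => mx_integral (fun s => W t s *m (cis (mu * s) *: (S *m b))) t).
  move=> cW [K [c [c0 WK]]].
  apply: (@bounded_forced_response _ _ _ _ _ (K * mxnorm1 b) c) => // t s st.
  rewrite mulmxA mulrAC; apply: le_trans (mxnorm1M _ _) _.
  by rewrite ler_wpM2r ?mxnorm1_ge0 ?WK.
move=> mu b _; split.
  apply: (bnd (evolU Phi) P) => //.
  exact: (evolU_decay hq hAcont hAper hPhi a0 PPhi decU).
apply: (bnd (evolV Phi) (1%:M - P)) => //.
exact: (evolV_decay hq hAcont hAper hPhi a'0 QPhi decV).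
Qed.
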